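(* Let $A(t)$ be an $N\times N$ complex matrix-valued function, analytic in a neighbourhood of $t=0$, and let $\mathcal{P}(h)$ be the fundamental matrix of $x'=A(t)x$ at time $h$, i.e. $\mathcal{P}'(t)=A(t)\mathcal{P}(t)$, $\mathcal{P}(0)=I$. Put $$c_1=\tfrac12-\tfrac{\sqrt3}{6},\quad c_2=\tfrac12+\tfrac{\sqrt3}{6},\quad A_i=A(c_ih),\quad \alpha_1=\tfrac{h}{2}(A_1+A_2),\quad \alpha_2=\sqrt{3}\,h\,(A_2-A_1),$$ and define the real coefficients $$w_{3,1}=w_{2,1}=\frac{1}{4-4^{1/3}},\qquad w_{1,1}=1-4w_{2,1},$$ $$w_{3,2}=\frac{7}{240(1-2w_{2,1})},\qquad w_{2,2}=\frac{1-12(1-w_{2,1})w_{3,2}}{12(1-3w_{2,1})}.$$ Then the five-fold composition of Cayley maps (product of matrices, in the order written) $$\Psi_h=\mathrm{Cay}(w_{3,1}\alpha_1+w_{3,2}\alpha_2)\,\mathrm{Cay}(w_{2,1}\alpha_1+w_{2,2}\alpha_2)\,\mathrm{Cay}(w_{1,1}\alpha_1)\,\mathrm{Cay}(w_{2,1}\alpha_1-w_{2,2}\alpha_2)\,\mathrm{Cay}(w_{3,1}\alpha_1-w_{3,2}\alpha_2)$$ defines a method of order four, that is, $$\Psi_h=\mathcal{P}(h)+\mathcal{O}(h^5)\qquad (h\to0).$$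
   Context: For a square matrix $X$ such that $I-\frac12X$ is invertible, $\mathrm{Cay}(X)=(I-\frac12X)^{-1}(I+\frac12X)$. All Cayley maps above are well defined for $|h|$ sufficiently small. *)

(* Defs.v *)
From HB Require Import structures.
From mathcomp Require Import all_boot all_order all_algebra.
From mathcomp Require Import all_classical all_reals all_analysis.
From mathcomp Require Import complex.
Set Implicit Arguments.
Unset Strict Implicit.
Unset Printing Implicit Defensive.
Import Order.TTheory GRing.Theory Num.Theory.
Import numFieldNormedType.Exports.
Local Open Scope classical_set_scope.
Local Open Scope ring_scope.
Local Open Scope complex_scope.

(* [Rcomplex R] is the type [R[i]] seen as a real vector space normed by the
   modulus. Making it a [normedModType R] gives access to the limits, derivatives
   and Landau notations of the library for complex functions of a real variable. *)
Fact Rcomplex_normrZ (R : realType) (l : R) (x : Rcomplex R) :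
  `|l *: x| = `|l| * `|x|.
Proof.
case: x => a b; rewrite /Num.norm/= /scalec/= !exprMn -mulrDr.
by rewrite sqrtrM ?sqr_ge0// sqrtr_sqr.
Qed.

HB.instance Definition _ (R : realType) :=
  PseudoMetric.copy (Rcomplex R) (pseudoMetric_normed (Rcomplex R)).
HB.instance Definition _ (R : realType) := isPointed.Build (Rcomplex R) 0.
HB.instance Definition _ (R : realType) :=
  NormedZmod_PseudoMetric_eq.Build R (Rcomplex R) erefl.
HB.instance Definition _ (R : realType) :=
  PseudoMetricNormedZmod_Lmodule_isNormedModule.Build R (Rcomplex R)
    (@Rcomplex_normrZ R).

Definition analytic_at (R : realType) (V : normedModType R) (f : R -> V) (c : R) :=
  exists a : nat -> V,
    \forall t \near c, series (fun k => (t - c) ^+ k *: a k) @ \oo --> f t.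

(* The entry [M t i j] as a function of the real time [t], with values in the
   real normed space of complex numbers. *)
Definition entry (R : realType) (N : nat) (M : R -> 'M[R[i]]_N) (i j : 'I_N) :
  R -> Rcomplex R := fun t => M t i j.

Definition analytic_near0 (R : realType) (N : nat) (A : R -> 'M[R[i]]_N) :=
  \forall t \near (0 : R), forall i j, analytic_at (entry A i j) t.

(* [P] only has to solve the equation near [0], which determines it there. *)
Definition fundamental_matrix (R : realType) (N : nat) (A P : R -> 'M[R[i]]_N) :=
  P 0 = 1%:M /\
  \forall t \near (0 : R), forall i j,
    is_derive t (1 : R) (entry P i j) ((A t *m P t) i j).

Definition matrix_bigO_pow (R : realType) (N : nat) (E : R -> 'M[R[i]]_N) (n : nat) :=
  forall i j, entry E i j =O_ (0 : R) (fun h : R => h ^+ n).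

(* Meaningful only when [1%:M - 2^-1 *: X] is a unit: [invmx] is the identity on
   singular matrices. *)
Definition Cay (K : fieldType) (N : nat) (X : 'M[K]_N) : 'M[K]_N :=
  invmx (1%:M - 2^-1 *: X) *m (1%:M + 2^-1 *: X).

Section CayleyComposition.
Variable R : realType.

Definition c1 : R := 2^-1 - Num.sqrt 3 / 6.
Definition c2 : R := 2^-1 + Num.sqrt 3 / 6.

Definition w21 : R := (4 - 4 `^ (3^-1))^-1.
Definition w31 : R := w21.
Definition w11 : R := 1 - 4 * w21.
Definition w32 : R := 7 / (240 * (1 - 2 * w21)).
Definition w22 : R := (1 - 12 * (1 - w21) * w32) / (12 * (1 - 3 * w21)).

Variables (N : nat) (A : R -> 'M[R[i]]_N) (h : R).

Definition alpha1 : 'M[R[i]]_N := (h / 2)%:C *: (A (c1 * h) + A (c2 * h)).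
Definition alpha2 : 'M[R[i]]_N :=
  (Num.sqrt 3 * h)%:C *: (A (c2 * h) - A (c1 * h)).

Definition Psi : 'M[R[i]]_N :=
  Cay (w31%:C *: alpha1 + w32%:C *: alpha2) *m
  Cay (w21%:C *: alpha1 + w22%:C *: alpha2) *m
  Cay (w11%:C *: alpha1) *m
  Cay (w21%:C *: alpha1 - w22%:C *: alpha2) *m
  Cay (w31%:C *: alpha1 - w32%:C *: alpha2).

End CayleyComposition.

(* Main.v *)
Require Import Defs.
From mathcomp Require Import all_boot all_order all_algebra.
From mathcomp Require Import all_classical all_reals all_analysis.
From mathcomp Require Import complex.
From mathcomp Require Import ring lra.
Set Implicit Arguments.
Unset Strict Implicit.
Unset Printing Implicit Defensive.
Import Order.TTheory GRing.Theory Num.Theory.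
Import numFieldNormedType.Exports.
Local Open Scope classical_set_scope.
Local Open Scope ring_scope.
Local Open Scope complex_scope.

(** Write [X = alpha1] and [Y = alpha2], so that [X = O(h)] and [Y = O(h^2)].
    The proof compares two expansions up to [O(h^5)].

    The method. Every factor [Cay (a X + b Y)] expands in noncommutative words
    in [X] and [Y], graded by giving [X] weight 1 and [Y] weight 2, since
    [Cay Z = 2 (1 - Z/2)^-1 - 1] and the resolvent is a geometric series
    ([Cay_word_expansion]). The coefficients of a product are computed by
    cutting words in two ([word_part_mul]), which turns the composition into a
    computation of the twelve words of weight below 5. The defining equations of
    the weights are exactly what this computation requires: [w21_cubic], which
    says that the cubes of the five weights of [X] add up to zero, cancels the
    error [Z^3 / 12] of the Cayley map compared to the exponential, and [w22E]
    gives the commutator of [X] and [Y] the coefficient [-1/12]. What remains is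
    the polynomial [magnus_poly], the truncation of [exp (X - [X, Y] / 12)]
    ([sum_word_part_Psi]).

    The solution. If [A] has Taylor coefficients [a k], the coefficients [p k] of
    the solution satisfy [(k + 1) p (k + 1) = sum_j a j p (k - j)]; this is proved
    one order at a time, by integrating remainders with the mean value theorem
    ([ode_taylor]).

    The comparison. The nodes [c1], [c2] are those of the Gauss quadrature rule,
    which integrates cubic polynomials exactly; hence [X] is the integral of [A]
    over [[0, h]] up to [O(h^5)], while [Y = a1 h^2 + a2 h^3 + O(h^4)].
    Substituting these series in [magnus_poly] gives the coefficients [p k] for
    [k < 5] ([magnus_coefE]). *)

(** * Matrices of size O(t^n) *)

Section MatrixNorm.
Variables (R : realType) (N : nat).
Implicit Types (M U V : 'M[R[i]]_N) (z : R[i]).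

(** The sum of the moduli of the entries is submultiplicative in every
    dimension, with constant 1. *)
Definition mnorm M : R := \sum_i \sum_j `|M i j : Rcomplex R|.

Lemma norm_RcomplexM z1 z2 :
  `|(z1 * z2 : Rcomplex R)| = `|(z1 : Rcomplex R)| * `|(z2 : Rcomplex R)|.
Proof. exact: ComplexField.Normc.normcM. Qed.

Lemma norm_real_complex (r : R) : `|(r%:C : Rcomplex R)| = `|r|.
Proof. by rewrite /Num.norm /= expr0n addr0 sqrtr_sqr. Qed.

Lemma mnorm_ge0 M : 0 <= mnorm M.
Proof. by apply: sumr_ge0 => i _; apply: sumr_ge0 => j _. Qed.

Lemma entry_le_mnorm M i j : `|M i j : Rcomplex R| <= mnorm M.
Proof.
rewrite /mnorm (bigD1 i) //= (bigD1 j) //= -addrA lerDl addr_ge0 //.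
  exact: sumr_ge0.
by apply: sumr_ge0 => ? _; apply: sumr_ge0.
Qed.

Lemma mnorm_eq0 M : mnorm M <= 0 -> M = 0.
Proof.
move=> M0; apply/matrixP => i j; rewrite mxE.
have : `|M i j : Rcomplex R| <= 0 by apply: le_trans M0; exact: entry_le_mnorm.
by rewrite normr_le0 => /eqP.
Qed.

Lemma mnorm0 : mnorm 0 = 0.
Proof.
rewrite /mnorm big1 // => i _; rewrite big1 // => j _.
by rewrite mxE -(normr0 (Rcomplex R)).
Qed.

Lemma ler_mnormD U V : mnorm (U + V) <= mnorm U + mnorm V.
Proof.
rewrite /mnorm -big_split ler_sum //= => i _.
rewrite -big_split ler_sum //= => j _.
rewrite mxE; exact: (@ler_normD _ (Rcomplex R)).
Qed.

Lemma mnormZ r M : mnorm (r%:C *: M) = `|r| * mnorm M.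
Proof.
rewrite /mnorm mulr_sumr; apply: eq_bigr => i _.
rewrite mulr_sumr; apply: eq_bigr => j _.
by rewrite mxE norm_RcomplexM norm_real_complex.
Qed.

(** The norm of the product is bounded by the sum of [|U i k| |V k j|] over all
    triples; bounding the sum of row [k] of [V] by the norm of [V] leaves the
    norm of [U]. *)
Lemma ler_mnormM U V : mnorm (U *m V) <= mnorm U * mnorm V.
Proof.
rewrite /mnorm mulr_suml ler_sum // => i _.
apply: (@le_trans _ _ (\sum_j \sum_k
    `|U i k : Rcomplex R| * `|V k j : Rcomplex R|)).
  apply: ler_sum => j _; rewrite mxE.
  apply: le_trans (ler_norm_sum _ _ _) _.
  by apply: ler_sum => k _; rewrite norm_RcomplexM.
rewrite exchange_big mulr_suml ler_sum //= => k _.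
rewrite -mulr_sumr ler_wpM2l //.
by rewrite [leRHS](bigD1 k) //= lerDl; apply: sumr_ge0 => ? _; apply: sumr_ge0.
Qed.

End MatrixNorm.

Section SmallMatrix.
Variables (R : realType) (N : nat).
Implicit Types (E F G : R -> 'M[R[i]]_N) (n : nat).

Definition small n E :=
  exists C : R, \forall t \near (0 : R), mnorm (E t) <= C * `|t| ^+ n.

Lemma near_norm_le (r : R) : 0 < r -> \forall t \near (0 : R), `|t| <= r.
Proof.
move=> r0; near=> t; apply/ltW.
suff : ball (0 : R) r t by rewrite /ball /= sub0r normrN.
near: t; exact: nbhsx_ballx.
Unshelve. all: by end_near. Qed.

Lemma small_near n E F :
  (\forall t \near (0 : R), E t = F t) -> small n F -> small n E.
Proof.
by move=> EF [C FC]; exists C; apply: filterS2 EF FC => t Et; rewrite Et.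
Qed.

Lemma small_eq n E F : (forall t, E t = F t) -> small n F -> small n E.
Proof. by move=> EF; apply: small_near; near=> t; exact: EF.
Unshelve. all: by end_near. Qed.

Lemma small_pos n E : small n E ->
  exists2 C : R, 0 < C & \forall t \near (0 : R), mnorm (E t) <= C * `|t| ^+ n.
Proof.
move=> [C EC]; exists (`|C| + 1) => //; apply: filterS EC => t /le_trans; apply.
by rewrite ler_wpM2r ?exprn_ge0 // (le_trans (ler_norm C)) // lerDl.
Qed.

Lemma small_le m n E : (m <= n)%N -> small n E -> small m E.
Proof.
move=> mn /small_pos[C C0 EC]; exists C.
apply: filterS2 EC (near_norm_le ltr01) => t /le_trans h t1; apply: h.
by rewrite ler_wpM2l ?(ltW C0) // ler_wiXn2l.
Qed.

Lemma smallD n E F : small n E -> small n F -> small n (fun t => E t + F t).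
Proof.
move=> [C EC] [D FD]; exists (C + D); apply: filterS2 EC FD => t Et Ft.
by rewrite mulrDl (le_trans (ler_mnormD _ _)) // lerD.
Qed.

Lemma smallM m n E F :
  small m E -> small n F -> small (m + n) (fun t => E t *m F t).
Proof.
move=> [C EC] [D FD]; exists (C * D); apply: filterS2 EC FD => t Et Ft.
rewrite exprD mulrACA (le_trans (ler_mnormM _ _)) //.
by apply: ler_pM => //; apply: mnorm_ge0.
Qed.

Lemma small_mulX k n E :
  small n E -> small (k + n) (fun t => (t ^+ k)%:C *: E t).
Proof.
move=> [C EC]; exists C; apply: filterS EC => t Et.
by rewrite mnormZ normrX exprD mulrCA ler_wpM2l // exprn_ge0.
Qed.

Lemma smallZ r n E : small n E -> small n (fun t => r%:C *: E t).
Proof.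
move=> [C EC]; exists (`|r| * C); apply: filterS EC => t Et.
by rewrite mnormZ -mulrA ler_wpM2l.
Qed.

Lemma smallN n E : small n E -> small n (fun t => - E t).
Proof.
move=> /(smallZ (-1)); apply: small_eq => t.
by rewrite rmorphN1 scaleN1r.
Qed.

Lemma smallB n E F : small n E -> small n F -> small n (fun t => E t - F t).
Proof. by move=> hE /smallN; apply: smallD. Qed.

Lemma small0 n : small n (fun=> 0).
Proof.
by exists 0; near=> t; rewrite mnorm0 mul0r.
Unshelve. all: by end_near. Qed.

Lemma small_cst M : small 0 (fun=> M).
Proof.
by exists (mnorm M); near=> t; rewrite expr0 mulr1.
Unshelve. all: by end_near. Qed.

Lemma small_sum (I : Type) (s : seq I) (p : pred I) n (E : I -> R -> 'M[R[i]]_N) :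
  (forall i, p i -> small n (E i)) ->
  small n (fun t => \sum_(i <- s | p i) E i t).
Proof.
move=> hE; elim: s => [|i s IH].
  by apply: small_eq (small0 n) => t; rewrite big_nil.
case pi : (p i); last by apply: small_eq IH => t; rewrite big_cons pi.
by apply: small_eq (smallD (hE i pi) IH) => t; rewrite big_cons pi.
Qed.

Lemma small_scale r n E : small n E -> small n (fun t => E (r * t)).
Proof.
move=> [C EC]; exists (C * `|r| ^+ n).
have r0 : (fun t : R => r * t) @ 0 --> (0 : R).
  by rewrite -[X in _ --> X](mulr0 r); apply: mulrl_continuous.
have rC : \forall t \near (0 : R), mnorm (E (r * t)) <= C * `|r * t| ^+ n.
  exact: r0 _ EC.
apply: filterS rC => t.
by rewrite normrM exprMn mulrA.
Qed.

Lemma small_bigO n E : small n E -> matrix_bigO_pow E n.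
Proof.
move=> /small_pos[C C0 EC] i j; apply/eqO_exP; exists C => //.
apply: filterS EC => t; rewrite normrX; apply: le_trans.
exact: entry_le_mnorm.
Qed.

Lemma small_entries n E :
  (forall i j, exists C : R, \forall t \near (0 : R),
     `|entry E i j t| <= C * `|t| ^+ n) -> small n E.
Proof.
move=> hE.
pose C i j := sval (cid (hE i j)).
have CE i j : \forall t \near (0 : R), `|entry E i j t| <= C i j * `|t| ^+ n.
  by rewrite /C; case: cid.
exists (\sum_i \sum_j C i j).
have {}CE : \forall t \near (0 : R),
    forall i j, `|entry E i j t| <= C i j * `|t| ^+ n.
  apply: (@filter_forall _ _ (fun i => [set t | forall j, _]) (nbhs (0 : R))) => i.
  exact: (@filter_forall _ _ (fun j => [set t | _]) (nbhs (0 : R)) _ (CE i)).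
apply: filterS CE => t Et; rewrite /mnorm mulr_suml ler_sum // => i _.
by rewrite mulr_suml ler_sum // => j _; apply: Et.
Qed.

End SmallMatrix.

(** * Graded expansions and their products *)

Section Expansion.
Variables (R : realType) (N : nat).
Implicit Types (E F G : R -> 'M[R[i]]_N) (J K : nat -> R -> 'M[R[i]]_N) (n : nat).

(** Asymptotic expansion along a grading: the term of degree [k] is allowed to
    depend on [t] in any way, as long as it is [O(t^k)]. Both Taylor polynomials
    and truncated series of words in two matrix functions have this form. *)
Definition expansion n F J :=
  (forall k, small k (J k)) /\ small n (fun t => F t - \sum_(k < n) J k t).

Lemma expansion_le m n F J : (m <= n)%N -> expansion n F J -> expansion m F J.
Proof.
move=> mn [hJ hF]; split => //.
have hR : small m (fun t => \sum_(m <= k < n | (m <= k < n)%N && true) J k t).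
  by apply: small_sum => k /andP[/andP[mk _] _]; apply: small_le (hJ k).
apply: small_eq (smallD (small_le mn hF) hR) => t.
rewrite -big_nat_cond -(big_mkord xpredT (J^~ t)) -(big_mkord xpredT (J^~ t)).
by rewrite (big_cat_nat (leq0n m) mn) /= opprD addrA subrK.
Qed.

Lemma expansion_unique n F G J :
  expansion n F J -> expansion n G J -> small n (fun t => F t - G t).
Proof.
move=> [_ hF] [_ hG]; apply: small_eq (smallB hF hG) => t.
by rewrite opprB addrA subrK.
Qed.

Lemma expansion_eq n F G J K :
  (forall t, F t = G t) -> (forall k t, J k t = K k t) ->
  expansion n F J -> expansion n G K.
Proof.
move=> FG JK [hJ hF]; split=> [k|]; first exact: small_eq (hJ k).
by apply: small_eq hF => t; rewrite FG; under eq_bigr do rewrite -JK.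
Qed.

Lemma expansionD n F G J K : expansion n F J -> expansion n G K ->
  expansion n (fun t => F t + G t) (fun k t => J k t + K k t).
Proof.
move=> [hJ hF] [hK hG]; split=> [k|]; first exact: smallD.
apply: small_eq (smallD hF hG) => t.
by rewrite big_split /= opprD addrACA.
Qed.

Lemma expansionZ n r F J : expansion n F J ->
  expansion n (fun t => r%:C *: F t) (fun k t => r%:C *: J k t).
Proof.
move=> [hJ hF]; split=> [k|]; first exact: smallZ.
by apply: small_eq (smallZ r hF) => t; rewrite -scaler_sumr scalerBr.
Qed.

Lemma sum_triangle n (f : nat -> nat -> 'M[R[i]]_N) :
  \sum_(m < n) \sum_(j < m.+1) f j (m - j)%N =
  \sum_(j < n) \sum_(k < n - j) f j k.
Proof.
elim: n => [|n IH]; first by rewrite !big_ord0.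
rewrite big_ord_recr IH [RHS]big_ord_recr /= subSnn big_ord1 big_ord_recr /=.
rewrite subnn addrA -big_split /=; congr (_ + _); apply: eq_bigr => j _.
by rewrite subSn ?(ltnW (ltn_ord j)) // big_ord_recr.
Qed.

(** The Cauchy product. Replace [F] by its partial sum, then, in front of the
    factor [J j], replace [G] by its partial sum of length [n - j] only: the
    error [O(t^(n - j))] is multiplied by [J j = O(t^j)]. *)
Lemma expansionM n F G J K : expansion n F J -> expansion n G K ->
  expansion n (fun t => F t *m G t)
    (fun m t => \sum_(j < m.+1) J j t *m K (m - j)%N t).
Proof.
move=> hF hG; have [hJ hFn] := hF; have [hK _] := hG; split=> [m|].
  apply: small_sum => j _; rewrite -[m in small m](subnKC (ltn_ord j : (j <= m)%N)).
  exact: smallM.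
have hG0 : small 0 G.
  have [_] := expansion_le (leq0n n) hG; apply: small_eq => t.
  by rewrite big_ord0 subr0.
have hFG : small n (fun t => (F t - \sum_(j < n) J j t) *m G t).
  by rewrite -[n in small n]addn0; apply: smallM.
have hJG : small n (fun t =>
    \sum_(j < n) J j t *m (G t - \sum_(k < n - j) K k t)).
  apply: small_sum => j _.
  rewrite -[n in small n](subnKC (ltnW (ltn_ord j))); apply: smallM => //.
  by have [] := expansion_le (leq_subr j n) hG.
apply: small_eq (smallD hFG hJG) => t.
rewrite (sum_triangle n (fun j k => J j t *m K k t)) mulmxBl mulmx_suml.
rewrite -addrA; congr (_ + _); rewrite -!sumrN -big_split /=.
by apply: eq_bigr => j _; rewrite mulmxBr mulmx_sumr addrA addNr add0r.
Qed.

End Expansion.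

(** * Series of words in two matrices *)

(** A formal series in the noncommuting letters [X] and [Y] is a function on
    words, a word being a list of booleans with [false] for [X] and [true] for
    [Y]. *)

Section Words.
Variables (R : realType) (N : nat).
Implicit Types (c d : seq bool -> R) (n : nat).

Definition residual c b := fun w : seq bool => c (b :: w).

(** The coefficient of [w] in a product is the sum of [c w1 * d w2] over all ways
    of cutting [w] into [w1 ++ w2]; the recursion moves the cut to the right. *)
Fixpoint word_mul c d (w : seq bool) : R :=
  c [::] * d w + (if w is b :: w' then word_mul (residual c b) d w' else 0).

(** The component of weight [n] of the series [c], evaluated at two matrices. It
    is organized by the first letter of the word: [X] of weight 1 or [Y] of
    weight 2. *)
Fixpoint word_part (X Y : 'M[R[i]]_N) n c {struct n} : 'M[R[i]]_N :=
  if n is n'.+1 then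
    X *m word_part X Y n' (residual c false) +
    (if n' is n''.+1 then Y *m word_part X Y n'' (residual c true) else 0)
  else (c [::])%:C%:M.

Section Fixed.
Variables X Y : 'M[R[i]]_N.
Local Notation word_part := (word_part X Y).

Lemma word_partSS n c : word_part n.+2 c =
  X *m word_part n.+1 (residual c false) + Y *m word_part n (residual c true).
Proof. by []. Qed.

Lemma word_partD n c d :
  word_part n (fun w => c w + d w) = word_part n c + word_part n d.
Proof.
elim/ltn_ind: n c d => -[|[|n]] IH c d; first by rewrite /= rmorphD raddfD.
  by rewrite /= !addr0 !rmorphD !raddfD.
rewrite !word_partSS.
have -> b : residual (fun w => c w + d w) b =
  (fun w => residual c b w + residual d b w) by [].
by rewrite (IH n.+1) // (IH n) // !mulmxDr addrACA.
Qed.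

Lemma word_partZ n r c : word_part n (fun w => r * c w) = r%:C *: word_part n c.
Proof.
elim/ltn_ind: n c => -[|[|n]] IH c.
- by rewrite /= rmorphM scale_scalar_mx.
- by rewrite /= !addr0 rmorphM -scale_scalar_mx scalemxAr.
rewrite !word_partSS.
have -> b : residual (fun w => r * c w) b = (fun w => r * residual c b w) by [].
by rewrite (IH n.+1) // (IH n) // -!scalemxAr scalerDr.
Qed.

(** By induction on the weight: a cut of [b :: w] is either in front of [b], which
    gives the term [j = 0], or behind it, which gives a cut of [w] for the series
    [residual c b]. *)
Lemma word_part_mul n c d :
  word_part n (word_mul c d) = \sum_(j < n.+1) word_part j c *m word_part (n - j) d.
Proof.
elim/ltn_ind: n c d => n IH c d; rewrite big_ord_recl subn0.
have residual_mul b : residual (word_mul c d) b =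
  (fun w => c [::] * residual d b w + word_mul (residual c b) d w) by [].
case: n IH => [|n] IH.
  by rewrite big_ord0 /= !addr0 rmorphM; exact: scalar_mxM.
have -> : word_part n.+1 (word_mul c d) = word_part 0 c *m word_part n.+1 d +
    (X *m word_part n (word_mul (residual c false) d) +
     (if n is m.+1 then Y *m word_part m (word_mul (residual c true) d) else 0)).
  rewrite [word_part 0 c]/= mul_scalar_mx; case: n IH => [|n] IH.
    rewrite -[word_part 1 _]/(X *m word_part 0 _ + 0).
    rewrite -[word_part 1 d]/(X *m word_part 0 _ + 0).
    by rewrite residual_mul word_partD word_partZ mulmxDr -scalemxAr !addr0.
  rewrite !word_partSS !residual_mul !word_partD !word_partZ.
  rewrite [X *m (_ *: _ + _)]mulmxDr [Y *m (_ *: _ + _)]mulmxDr.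
  by rewrite -!scalemxAr scalerDr addrACA.
congr (_ + _).
under eq_bigr do rewrite -[word_part (lift _ _) c]/(_ + _) mulmxDl -mulmxA.
rewrite big_split -mulmx_sumr /= IH //; congr (_ *m _ + _).
case: n IH => [|n] IH; first by rewrite big_ord_recl big_ord0 /= mul0mx addr0.
rewrite [RHS]big_ord_recl /= mul0mx add0r IH // mulmx_sumr.
by apply: eq_bigr => j _; rewrite mulmxA.
Qed.

End Fixed.
End Words.

(** * Expansion of the Cayley map in words *)

Section WordExpansion.
Variables (R : realType) (N : nat) (X Y : R -> 'M[R[i]]_N).
Hypotheses (X_small : small 1 X) (Y_small : small 2 Y).
Implicit Types (F G : R -> 'M[R[i]]_N) (c d : seq bool -> R) (n : nat).

Lemma small_word_part k c : small k (fun t => word_part (X t) (Y t) k c).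
Proof.
elim/ltn_ind: k c => -[|[|k]] IH c; first exact: small_cst.
  apply: small_eq (smallM X_small (IH 0%N isT (residual c false))) => t.
  exact: addr0.
apply: smallD; first exact: smallM X_small (IH k.+1 _ _).
by apply: smallM Y_small (IH k _ _).
Qed.

Definition word_expansion F c :=
  forall n, expansion n F (fun k t => word_part (X t) (Y t) k c).

Lemma word_expansionM F G c d : word_expansion F c -> word_expansion G d ->
  word_expansion (fun t => F t *m G t) (word_mul c d).
Proof.
move=> hF hG n; apply: expansion_eq (expansionM (hF n) (hG n)) => // k t.
by rewrite word_part_mul.
Qed.

Lemma word_expansion_lin r s F G c d :
  word_expansion F c -> word_expansion G d ->
  word_expansion (fun t => r%:C *: F t + s%:C *: G t)
    (fun w => r * c w + s * d w).
Proof.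
move=> hF hG n.
have h := expansionD (expansionZ r (hF n)) (expansionZ s (hG n)).
apply: expansion_eq h => // k t.
by rewrite word_partD !word_partZ.
Qed.

Definition word_one (w : seq bool) : R := (w == [::])%:R.

Lemma word_expansion1 : word_expansion (fun=> 1%:M) word_one.
Proof.
move=> n; split=> [k|]; first exact: small_word_part.
case: n => [|n].
  by apply: small_eq (small_cst 1%:M) => t; rewrite big_ord0 subr0.
apply: small_eq (small0 _ _ _) => t.
have part0 k : word_part (X t) (Y t) k (fun=> 0) = 0.
  have := word_partZ (X t) (Y t) k 0 (fun=> 0).
  by under [X in word_part _ _ _ X]eq_fun do rewrite mul0r; rewrite scale0r.
rewrite big_ord_recl /= rmorph1 big1 ?addr0 ?subrr // => k _.
by rewrite add0n !part0 mulmx0 add0r; case: (k : nat) => // m; rewrite part0 mulmx0.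
Qed.

(** The coefficients of the geometric series of [Z / 2], for [Z = a X + b Y]. *)
Fixpoint resolvent_coef (a b : R) (w : seq bool) : R :=
  if w is x :: w' then (if x then b else a) / 2 * resolvent_coef a b w' else 1.

Lemma word_part_resolventS a b (U V : 'M[R[i]]_N) k :
  word_part U V k.+1 (resolvent_coef a b) =
  (a / 2)%:C *: (U *m word_part U V k (resolvent_coef a b)) +
  (if k is m.+1
   then (b / 2)%:C *: (V *m word_part U V m (resolvent_coef a b)) else 0).
Proof.
have resolvent_coefS x : residual (resolvent_coef a b) x =
  (fun w => (if x then b else a) / 2 * resolvent_coef a b w).
  by [].
have -> : word_part U V k.+1 (resolvent_coef a b) =
  U *m word_part U V k (residual (resolvent_coef a b) false) +
  (if k is m.+1
   then V *m word_part U V m (residual (resolvent_coef a b) true) else 0) by [].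
rewrite resolvent_coefS word_partZ -scalemxAr; congr (_ + _).
by case: k => [//|k]; rewrite resolvent_coefS word_partZ -scalemxAr.
Qed.

(** The equation [F = 1 + (1/2) Z F] improves remainders: the one of order [n + 1]
    is [(a/2) X] times the one of order [n] plus [(b/2) Y] times the one of order
    [n - 1]. Boundedness of [F] starts the induction. *)
Lemma resolvent_word_expansion a b F :
  (\forall t \near (0 : R),
     F t = 1%:M + 2^-1 *: ((a%:C *: X t + b%:C *: Y t) *m F t)) ->
  small 0 F -> word_expansion F (resolvent_coef a b).
Proof.
move=> eqF F0; suff hF n : small n (fun t =>
    F t - \sum_(k < n) word_part (X t) (Y t) k (resolvent_coef a b)).
  by move=> n; split=> [k|//]; apply: small_word_part.
elim/ltn_ind: n => -[|n] IH.
  by apply: small_eq F0 => t; rewrite big_ord0 subr0.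
have hX := smallZ (a / 2) (smallM X_small (IH n (ltnSn n))).
have hY : small n.+1 (fun t => (b / 2)%:C *:
    (Y t *m (F t - \sum_(k < n.-1) word_part (X t) (Y t) k (resolvent_coef a b)))).
  case: n IH {hX} => [|n] IH; apply: smallZ.
    exact: small_le (smallM Y_small (IH 0%N isT)).
  exact: smallM Y_small (IH n _).
apply: small_near (smallD hX hY); apply: filterS eqF => t {1}->.
rewrite big_ord_recl [word_part _ _ ord0 _]/= rmorph1.
under eq_bigr do rewrite lift0 word_part_resolventS.
rewrite big_split -scaler_sumr -mulmx_sumr /=.
have -> : \sum_(k < n) (if k : nat is m.+1 then
    (b / 2)%:C *: (Y t *m word_part (X t) (Y t) m (resolvent_coef a b)) else 0) =
    (b / 2)%:C *:
      (Y t *m \sum_(k < n.-1) word_part (X t) (Y t) k (resolvent_coef a b)).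
  case: n {IH hX hY} => [|n]; first by rewrite !big_ord0 mulmx0 scaler0.
  by rewrite big_ord_recl add0r mulmx_sumr scaler_sumr.
rewrite opprD addrACA subrr add0r mulmxDl -!scalemxAl scalerDr !scalerA.
have half (r : R) : 2^-1 * r%:C = (r / 2)%:C.
  by rewrite mulrC rmorphM fmorphV rmorph_nat.
by rewrite !half !mulmxBr !scalerBr opprD addrACA.
Qed.

(** If [K (1 - M) = 0] then [K = K M] has norm at most half of itself, so [1 - M]
    is injective; the same estimate for [V = 1 + M V] bounds the inverse. *)
Lemma unit_1subm (M : 'M[R[i]]_N) : mnorm M <= 2^-1 ->
  1%:M - M \in unitmx /\ mnorm (invmx (1%:M - M)) <= 2 * mnorm (1%:M : 'M[R[i]]_N).
Proof.
move=> M2; have U : 1%:M - M \in unitmx.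
  rewrite -row_free_unit -kermx_eq0; apply/eqP/mnorm_eq0.
  have : kermx (1%:M - M) *m (1%:M - M) = 0 by exact: mulmx_ker.
  rewrite mulmxBr mulmx1 => /eqP; rewrite subr_eq0 => /eqP KM.
  have := ler_mnormM (kermx (1%:M - M)) M; rewrite -KM.
  have := mnorm_ge0 (kermx (1%:M - M)); have := mnorm_ge0 M.
  nra.
split=> //; set V := invmx _.
have VE : V = 1%:M + M *m V.
  have := mulmxV U; rewrite -/V mulmxBl mul1mx => /eqP.
  by rewrite subr_eq => /eqP.
have := ler_mnormD 1%:M (M *m V); rewrite -VE.
have := ler_mnormM M V; have := mnorm_ge0 V; have := mnorm_ge0 M.
nra.
Qed.

(** The Cayley map is [2 (1 - Z/2)^-1 - 1]. *)
Definition cay_coef (a b : R) w := 2 * resolvent_coef a b w + (-1) * word_one w.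

Lemma Cay_word_expansion a b :
  word_expansion (fun t => Cay (a%:C *: X t + b%:C *: Y t)) (cay_coef a b).
Proof.
pose Z t := a%:C *: X t + b%:C *: Y t; pose U t := 1%:M - 2^-1 *: Z t.
have Z_small : small 1 Z.
  apply: smallD; first exact: smallZ.
  by apply: smallZ; apply: small_le Y_small.
have half (t : R) : 2^-1 *: Z t = (2^-1)%:C *: Z t by rewrite fmorphV rmorph_nat.
have Z2 : \forall t \near (0 : R), mnorm (2^-1 *: Z t) <= 2^-1.
  have [C C0 ZC] := small_pos Z_small.
  have Ci : 0 < C^-1 by rewrite invr_gt0.
  apply: filterS2 ZC (near_norm_le Ci) => t Zt tC.
  rewrite half mnormZ ger0_norm ?invr_ge0 // ler_piMr ?invr_ge0 //.
  apply: le_trans Zt _; rewrite expr1 -(mulfV (lt0r_neq0 C0)).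
  by rewrite ler_wpM2l // ltW.
pose F t := invmx (U t).
have F_expansion : word_expansion F (resolvent_coef a b).
  apply: resolvent_word_expansion.
    apply: filterS Z2 => t /unit_1subm[Ut _].
    have := mulmxV Ut; rewrite -/(U t) -/(F t) {1}/U mulmxBl mul1mx => /eqP.
    by rewrite subr_eq -scalemxAl => /eqP.
  exists (2 * mnorm (1%:M : 'M[R[i]]_N)).
  by apply: filterS Z2 => t /unit_1subm[_]; rewrite expr0 mulr1.
move=> n; have [hJ hF] := word_expansion_lin 2 (-1) F_expansion word_expansion1 n.
split=> //; apply: small_near hF.
apply: filterS Z2 => t /unit_1subm[Ut _]; congr (_ - _).
rewrite /Cay -/(Z t) -/(U t).
have -> : 1%:M + 2^-1 *: Z t = 2 *: 1%:M - U t.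
  by rewrite /U scaler_nat mulr2n opprB addrACA subrr addr0 ?addrA addrC.
rewrite mulmxBr mulVmx // -scalemxAr mulmx1.
by rewrite rmorphN1 scaleN1r rmorph_nat.
Qed.
End WordExpansion.

(** * The words of weight below five in the composition *)

Lemma sum_word_part5 (R : realType) (N : nat) (X Y : 'M[R[i]]_N) (c : seq bool -> R) :
  let x := false in let y := true in
  \sum_(k < 5) word_part X Y k c = (c [::])%:C *: 1%:M + (c [:: x])%:C *: X
    + ((c [:: x; x])%:C *: (X *m X) + (c [:: y])%:C *: Y)
    + ((c [:: x; x; x])%:C *: (X *m (X *m X)) + (c [:: x; y])%:C *: (X *m Y)
       + (c [:: y; x])%:C *: (Y *m X))
    + ((c [:: x; x; x; x])%:C *: (X *m (X *m (X *m X)))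
       + (c [:: x; x; y])%:C *: (X *m (X *m Y))
       + (c [:: x; y; x])%:C *: (X *m (Y *m X))
       + ((c [:: y; x; x])%:C *: (Y *m (X *m X)) + (c [:: y; y])%:C *: (Y *m Y))).
Proof.
move=> x y.
have sum5 (f : nat -> 'M[R[i]]_N) :
    \sum_(k < 5) f k = f 0%N + f 1%N + f 2%N + f 3%N + f 4%N.
  by rewrite !big_ord_recr big_ord0 /= add0r.
rewrite (sum5 (fun k => word_part X Y k c)) !word_partSS.
have word_part0E d : word_part X Y 0 d = (d [::])%:C *: 1%:M by rewrite scalemx1.
have word_part1E d : word_part X Y 1 d = (d [:: x])%:C *: X.
  rewrite -[word_part _ _ 1 d]/(X *m word_part X Y 0 (residual d x) + 0).
  by rewrite word_part0E addr0 -scalemxAr mulmx1.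
rewrite !word_part1E !word_part0E -!scalemxAr !mulmx1.
by rewrite ![X *m (_ + _)]mulmxDr [Y *m (_ + _)]mulmxDr -!scalemxAr.
Qed.

(** The part of weight below 5 of [exp (X - [X, Y] / 12)]: the terms
    [- ([X, Y] X + X [X, Y]) / 24] of its square collapse to
    [- (X X Y - Y X X) / 24]. *)
Definition magnus_poly (R : realType) (N : nat) (X Y : 'M[R[i]]_N) :=
  1%:M + X + (2^-1)%:C *: (X *m X)
  + ((6^-1)%:C *: (X *m (X *m X)) - (12^-1)%:C *: (X *m Y - Y *m X))
  + ((24^-1)%:C *: (X *m (X *m (X *m X)))
     - (24^-1)%:C *: (X *m (X *m Y) - Y *m (X *m X))).

(** Stated in an abstract module, where rewriting does not attempt to unfold
    complex matrices. *)
Lemma collect_words (K : pzRingType) (V : lmodType K) (a b c e : K)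
    (I X Y XX XXX XY YX XXXX XXY XYX YXX YY : V) :
  1 *: I + 1 *: X + (a *: XX + 0 *: Y) + (b *: XXX + - c *: XY + c *: YX) +
    (e *: XXXX + - e *: XXY + 0 *: XYX + (e *: YXX + 0 *: YY)) =
  I + X + a *: XX + (b *: XXX - c *: (XY - YX)) + (e *: XXXX - e *: (XXY - YXX)).
Proof.
rewrite !scale1r !scale0r !addr0 !scaleNr !scalerBr !opprB.
by congr (_ + _ + _); rewrite -addrA [- _ + _]addrC.
Qed.

Section Coefficients.
Variables (R : realType) (w u v : R).
Local Notation x := false.
Local Notation y := true.

(** The composition is symmetric: [u] and [v], the coefficients of [Y] in the
    first two factors, reappear with the opposite sign in the last two. Hence the
    words [Y], [Y Y] and [X Y X] have coefficient 0 for all values of [w], [u]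
    and [v]. *)
Definition psi_coef := word_mul (word_mul (word_mul (word_mul
  (cay_coef w u) (cay_coef w v)) (cay_coef (1 - 4 * w) 0))
  (cay_coef w (- v))) (cay_coef w (- u)).

Ltac compute_coefficient :=
  rewrite /psi_coef /word_mul /residual /cay_coef /word_one /=; by field.

Lemma psi_coef1 : psi_coef [::] = 1. Proof. compute_coefficient. Qed.
Lemma psi_coef_x : psi_coef [:: x] = 1. Proof. compute_coefficient. Qed.
Lemma psi_coef_y : psi_coef [:: y] = 0. Proof. compute_coefficient. Qed.
Lemma psi_coef_xx : psi_coef [:: x; x] = 2^-1. Proof. compute_coefficient. Qed.
Lemma psi_coef_yy : psi_coef [:: y; y] = 0. Proof. compute_coefficient. Qed.
Lemma psi_coef_xyx : psi_coef [:: x; y; x] = 0. Proof. compute_coefficient. Qed.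

(** The other coefficients agree with those of [exp (X - [X, Y] / 12)] up to a
    multiple of one of the two order conditions. *)
Lemma psi_coef_xxx : psi_coef [:: x; x; x] =
  6^-1 + (4 * w ^+ 3 + (1 - 4 * w) ^+ 3) / 12.
Proof. compute_coefficient. Qed.

Lemma psi_coef_xxxx : psi_coef [:: x; x; x; x] =
  24^-1 + (4 * w ^+ 3 + (1 - 4 * w) ^+ 3) / 12.
Proof. compute_coefficient. Qed.

Lemma psi_coef_xy : psi_coef [:: x; y] =
  - 12^-1 - (12 * (1 - w) * u + 12 * (1 - 3 * w) * v - 1) / 12.
Proof. compute_coefficient. Qed.

Lemma psi_coef_yx : psi_coef [:: y; x] =
  12^-1 + (12 * (1 - w) * u + 12 * (1 - 3 * w) * v - 1) / 12.
Proof. compute_coefficient. Qed.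

Lemma psi_coef_xxy : psi_coef [:: x; x; y] =
  - 24^-1 - (12 * (1 - w) * u + 12 * (1 - 3 * w) * v - 1) / 24.
Proof. compute_coefficient. Qed.

Lemma psi_coef_yxx : psi_coef [:: y; x; x] =
  24^-1 + (12 * (1 - w) * u + 12 * (1 - 3 * w) * v - 1) / 24.
Proof. compute_coefficient. Qed.

Hypothesis w_cubic : 4 * w ^+ 3 + (1 - 4 * w) ^+ 3 = 0.
Hypothesis wuv : 12 * (1 - w) * u + 12 * (1 - 3 * w) * v = 1.

Lemma sum_word_part_Psi (N : nat) (X Y : 'M[R[i]]_N) :
  \sum_(k < 5) word_part X Y k psi_coef = magnus_poly X Y.
Proof.
rewrite /magnus_poly sum_word_part5.
(* The series is made opaque: unifying two of its coefficients would otherwise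
   compute both of them. *)
move: psi_coef1 psi_coef_x psi_coef_y psi_coef_xx psi_coef_yy psi_coef_xyx.
move: psi_coef_xxx psi_coef_xxxx psi_coef_xy psi_coef_yx psi_coef_xxy psi_coef_yxx.
rewrite w_cubic wuv subrr !mul0r !subr0 !addr0; move: psi_coef => c.
do 12! move=> ->.
have -> : 1%:C = 1 :> R[i] by [].
have -> : 0%:C = 0 :> R[i] by [].
rewrite !(rmorphN (real_complex R)).
exact: collect_words.
Qed.
End Coefficients.

(** The two order conditions hold for the weights of the method. *)
Section Weights.
Variable R : realType.
Notation w21 := (w21 R). Notation w22 := (w22 R). Notation w32 := (w32 R).

Lemma cbrt4_cubed : (4 `^ (3^-1) : R) ^+ 3 = 4.
Proof. by rewrite -powR_mulrn ?powR_ge0 // -powRrM mulVf // powRr1. Qed.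

Lemma w21E : (4 - 4 `^ (3^-1)) * w21 = 1.
Proof.
rewrite /w21 mulfV // subr_eq0; apply/eqP => e.
by have := cbrt4_cubed; rewrite -e; lra.
Qed.

Lemma w21_cubic : 4 * w21 ^+ 3 + (1 - 4 * w21) ^+ 3 = 0.
Proof.
have -> : 1 - 4 * w21 = - (4 `^ (3^-1) * w21) by have := w21E; lra.
by rewrite exprNn exprMn cbrt4_cubed; ring.
Qed.

(** The denominator [1 - 3 w21] is not zero, because [1/3] is not a root of the
    cubic equation satisfied by [w21]. *)
Lemma w22E : 12 * (1 - w21) * w32 + 12 * (1 - 3 * w21) * w22 = 1.
Proof.
have w3 : 1 - 3 * w21 != 0.
  apply/eqP => w3; have e : w21 = 3^-1 by lra.
  by have := w21_cubic; rewrite e; lra.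
rewrite /w22; field.
by rewrite w3.
Qed.
End Weights.

(** * Analytic tools *)

Lemma geometric_tail (R : realType) (q : R) (n m : nat) : 0 <= q -> q <= 2^-1 ->
  \sum_(n <= k < n + m) q ^+ k <= 2 * q ^+ n - 2 * q ^+ (n + m).
Proof.
move=> q0 q2; elim: m => [|m IH]; first by rewrite addn0 big_geq // subrr.
rewrite addnS big_nat_recr ?leq_addr //= exprS.
have := exprn_ge0 (n + m) q0; nra.
Qed.

(** The terms of the series are bounded at some [s > 0], hence for [|t| <= s / 2]
    the tail is dominated by a geometric series of ratio at most [1/2]. *)
Lemma power_series_remainder (R : realType) (V : normedModType R) (f : R -> V)
    (a : nat -> V) (n : nat) :
  (\forall t \near (0 : R), series (fun k => t ^+ k *: a k) @ \oo --> f t) ->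
  exists C : R, \forall t \near (0 : R),
    `|f t - \sum_(k < n) t ^+ k *: a k| <= C * `|t| ^+ n.
Proof.
move=> fa; have /nbhs_ballP[r /= r0 rf] := fa.
have [s s0 sr] : exists2 s : R, 0 < s & s < r by exists (r / 2); lra.
have [M M0 aM] : exists2 M : R, 0 <= M & forall k, `|a k| * s ^+ k <= M.
  have sf : series (fun k => s ^+ k *: a k) @ \oo --> f s.
    by apply: rf; rewrite /ball /= sub0r normrN gtr0_norm.
  have /cvg_series_cvg_0 := cvgP _ sf.
  move=> /cvgP /cvg_seq_bounded [M [_ aM]].
  exists (`|M| + 1) => // k.
  have /= := aM (`|M| + 1) _ k I; rewrite normrZ normrX gtr0_norm // mulrC; apply.
  by rewrite (le_lt_trans (ler_norm M)) // ltrDl.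
exists (2 * M / s ^+ n).
have s2 : 0 < s / 2 by rewrite divr_gt0.
apply: filterS2 fa (near_norm_le s2) => t ft ts.
set S := \sum_(k < n) _; set B := _ * _.
have cvS : `|series (fun k => t ^+ k *: a k) m - S| @[m --> \oo] --> `|f t - S|.
  by apply: cvg_norm; apply: cvgB => //; exact: cvg_cst.
apply: (cvgr_to_le cvS).
near=> m.
have nm : (n <= m)%N by near: m; exact: nbhs_infty_ge.
rewrite /series /= (big_cat_nat (leq0n n) nm) /= big_mkord addrAC subrr add0r.
apply: le_trans (ler_norm_sum _ _ _) _.
pose q := `|t| / s.
have q0 : 0 <= q by rewrite divr_ge0 // ltW.
have q2 : q <= 2^-1 by rewrite ler_pdivrMr // mulrC.
apply: (@le_trans _ _ (\sum_(n <= k < m) M * q ^+ k)).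
  apply: ler_sum => k _; rewrite normrZ normrX /q expr_div_n mulrCA.
  by rewrite ler_wpM2l // ler_pdivlMr ?exprn_gt0.
rewrite -mulr_sumr -(subnKC nm).
have := geometric_tail n (m - n) q0 q2.
have qm : 0 <= q ^+ (n + (m - n)) by apply: exprn_ge0.
have -> : B = M * (2 * q ^+ n).
  by rewrite /B /q expr_div_n; ring.
move=> h; apply: ler_wpM2l => //; lra.
Unshelve. all: by end_near. Qed.

(** Integration of remainders: a function that vanishes at 0 gains one order
    over its derivative. For complex values the mean value theorem is applied to
    the real and imaginary parts, which costs a factor 2. *)
Section MeanValue.
Variable R : realType.

Lemma real_mean_value_bigO (f df : R -> R) (n : nat) (C : R) :
  0 <= C -> f 0 = 0 ->
  (\forall t \near (0 : R), is_derive (t : R) (1 : R) f (df t)) ->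
  (\forall t \near (0 : R), `|df t| <= C * `|t| ^+ n) ->
  \forall t \near (0 : R), `|f t| <= C * `|t| ^+ n.+1.
Proof.
move=> C0 f0 fdf dfC.
have {fdf dfC}dfP : \forall t \near (0 : R),
    is_derive (t : R) (1 : R) f (df t) /\ `|df t| <= C * `|t| ^+ n.
  exact: filterI fdf dfC.
have /nbhs_ballP[r /= r0 rP] := dfP.
have rP' t : `|t| < r ->
    is_derive (t : R) (1 : R) f (df t) /\ `|df t| <= C * `|t| ^+ n.
  by move=> tr; apply: rP; rewrite /ball /= sub0r normrN.
exists r => // t; rewrite /ball /= sub0r normrN => tr.
(* The interval from [a] to [b] is either [[0, t]] or [[t, 0]]. *)
have mv (a b : R) : a <= b -> (forall x, a <= x <= b -> `|x| <= `|t|) ->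
    `|f b - f a| <= C * `|t| ^+ n * `|b - a|.
  move=> ab abt.
  have abD (x : R) : x \in `[a, b] -> is_derive (x : R) (1 : R) f (df x).
    by rewrite in_itv /= => /abt xt; have [] := rP' x (le_lt_trans xt tr).
  have [c] : exists2 c, c \in `[a, b] & f b - f a = df c * (b - a).
    have fcont : {within `[a, b], continuous f}.
      by apply: derivable_within_continuous => x xab; have [] := abD x xab.
    have fdf (x : R) : x \in `]a, b[ -> is_derive (x : R) (1 : R) f (df x).
      by move=> xab; apply: abD; apply: subset_itv_oo_cc xab.
    exact: MVT_segment ab fdf fcont.
  rewrite in_itv /= => /abt ct ->; rewrite normrM ler_wpM2r //.
  have [_ /le_trans] := rP' c (le_lt_trans ct tr); apply.
  by rewrite ler_wpM2l // lerXn2r // ?nnegrE // ct.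
rewrite exprSr mulrA; case: (leP 0 t) => t0.
  have := mv 0 t t0; rewrite f0 !subr0; apply => x /andP[x0 xt].
  by rewrite !ger0_norm.
have := mv t 0 (ltW t0); rewrite f0 !sub0r !normrN; apply => x /andP[tx x0].
by rewrite !ler0_norm ?lerN2 // ltW.
Qed.

Lemma is_derive_linear (V W : normedModType R) (g : V -> W)
    (f : R -> V) (t : R) (df : V) :
  (forall x y, g (x - y) = g x - g y) -> (forall (r : R) x, g (r *: x) = r *: g x) ->
  continuous g -> is_derive (t : R) (1 : R) f df ->
  is_derive (t : R) (1 : R) (g \o f) (g df).
Proof.
move=> gB gZ cg [fd fE].
have h : (fun h : R => h^-1 *: ((g \o f \o shift t) (h *: 1) - (g \o f) t)) @
    0^' --> g df.
  have -> : (fun h : R => h^-1 *: ((g \o f \o shift t) (h *: 1) - (g \o f) t)) =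
      g \o (fun h : R => h^-1 *: ((f \o shift t) (h *: 1) - f t)).
    apply/funext => h /=; by rewrite gZ gB.
  rewrite -fE; apply: continuous_cvg; first exact: cg.
  exact: fd.
by apply: DeriveDef; [apply/cvg_ex; exists (g df)|exact: cvg_lim h].
Qed.

Lemma norm_le_ReIm (z : Rcomplex R) : `|z| <= `|complex.Re z| + `|complex.Im z|.
Proof.
case: z => a b; rewrite {1}/Num.norm /=.
rewrite -[leRHS]ger0_norm ?addr_ge0 // -sqrtr_sqr ler_wsqrtr //.
by rewrite sqrrD !real_normK ?num_real // lerD2r lerDl mulrn_wge0 // mulr_ge0.
Qed.

Lemma Re_le_norm (z : Rcomplex R) : `|complex.Re z| <= `|z|.
Proof.
case: z => a b; rewrite {2}/Num.norm /= -sqrtr_sqr ler_wsqrtr //.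
by rewrite lerDl sqr_ge0.
Qed.

Lemma Im_le_norm (z : Rcomplex R) : `|complex.Im z| <= `|z|.
Proof.
case: z => a b; rewrite {2}/Num.norm /= -sqrtr_sqr ler_wsqrtr //.
by rewrite lerDr sqr_ge0.
Qed.

Lemma linear_contraction_continuous (V W : normedModType R)
    (g : {linear V -> W}) : (forall x, `|g x| <= `|x|) -> continuous g.
Proof.
move=> g1 z; apply/cvgrPdist_le => e e0; near=> w.
rewrite -raddfB; apply: le_trans (g1 _) _.
by near: w; apply: cvgr_dist_le.
Unshelve. all: by end_near. Qed.

Lemma Re_continuous : continuous (@complex.Re R : Rcomplex R -> R).
Proof. exact: linear_contraction_continuous Re_le_norm. Qed.

Lemma Im_continuous : continuous (@complex.Im R : Rcomplex R -> R).
Proof. exact: linear_contraction_continuous Im_le_norm. Qed.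

Lemma complex_mean_value_bigO (f df : R -> Rcomplex R) (n : nat) (C : R) :
  0 <= C -> f 0 = 0 ->
  (\forall t \near (0 : R), is_derive (t : R) (1 : R) f (df t)) ->
  (\forall t \near (0 : R), `|df t| <= C * `|t| ^+ n) ->
  \forall t \near (0 : R), `|f t| <= 2 * C * `|t| ^+ n.+1.
Proof.
move=> C0 f0 fdf dfC.
have fRe : \forall t \near (0 : R), `|complex.Re (f t)| <= C * `|t| ^+ n.+1.
  apply: (@real_mean_value_bigO (@complex.Re R \o f) (@complex.Re R \o df)) => //=.
  - by rewrite f0.
  - apply: filterS fdf => t; apply: is_derive_linear Re_continuous => [x y|r x].
      by rewrite raddfB.
    by rewrite linearZ.
  - by apply: filterS dfC => t; apply: le_trans; apply: Re_le_norm.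
have fIm : \forall t \near (0 : R), `|complex.Im (f t)| <= C * `|t| ^+ n.+1.
  apply: (@real_mean_value_bigO (@complex.Im R \o f) (@complex.Im R \o df)) => //=.
  - by rewrite f0.
  - apply: filterS fdf => t; apply: is_derive_linear Im_continuous => [x y|r x].
      by rewrite raddfB.
    by rewrite linearZ.
  - by apply: filterS dfC => t; apply: le_trans; apply: Im_le_norm.
apply: filterS2 fRe fIm => t Ret Imt.
by rewrite (le_trans (norm_le_ReIm _)) // -mulrA mulr_natl mulr2n lerD.
Qed.
End MeanValue.

(** * Comparison of the Taylor coefficients *)

(** This part is pure algebra and holds over any field of numbers. *)

Definition cauchy (K : fieldType) (N : nat) (f g : nat -> 'M[K]_N) (k : nat) :=
  \sum_(j < k.+1) f j *m g (k - j)%N.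

(** The first Taylor coefficients of the solution of [P' = A P], [P 0 = 1]; see
    [ode_coefS] for the recursion. *)
Definition ode_coef (K : fieldType) (N : nat) (a : nat -> 'M[K]_N) (k : nat) :=
  let p1 := a 0%N in
  let p2 := 2^-1 *: (a 1%N + a 0%N *m p1) in
  let p3 := 3^-1 *: (a 2%N + a 1%N *m p1 + a 0%N *m p2) in
  let p4 := 4^-1 *: (a 3%N + a 2%N *m p1 + a 1%N *m p2 + a 0%N *m p3) in
  nth 0 [:: 1%:M; p1; p2; p3; p4] k.

(** The Taylor coefficients of [magnus_poly X Y], if [X] and [Y] have the Taylor
    coefficients [x] and [y]. *)
Definition magnus_coef (K : fieldType) (N : nat) (x y : nat -> 'M[K]_N) (k : nat) :=
  (if k is 0%N then 1%:M else 0) + x k + 2^-1 *: cauchy x x k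
  + (6^-1 *: cauchy x (cauchy x x) k - 12^-1 *: (cauchy x y k - cauchy y x k))
  + (24^-1 *: cauchy x (cauchy x (cauchy x x)) k
     - 24^-1 *: (cauchy x (cauchy x y) k - cauchy y (cauchy x x) k)).

Section CauchyExpansion.
Variables (K : fieldType) (N : nat) (f g : nat -> 'M[K]_N).

Lemma cauchy0E : cauchy f g 0 = f 0%N *m g 0%N.
Proof. exact: big_ord1. Qed.

Lemma cauchy1E : cauchy f g 1 = f 0%N *m g 1%N + f 1%N *m g 0%N.
Proof. by rewrite /cauchy !big_ord_recr big_ord0 /= add0r. Qed.

Lemma cauchy2E :
  cauchy f g 2 = f 0%N *m g 2%N + f 1%N *m g 1%N + f 2%N *m g 0%N.
Proof. by rewrite /cauchy !big_ord_recr big_ord0 /= add0r. Qed.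

Lemma cauchy3E : cauchy f g 3 =
  f 0%N *m g 3%N + f 1%N *m g 2%N + f 2%N *m g 1%N + f 3%N *m g 0%N.
Proof. by rewrite /cauchy !big_ord_recr big_ord0 /= add0r. Qed.

Lemma cauchy4E : cauchy f g 4 =
  f 0%N *m g 4%N + f 1%N *m g 3%N + f 2%N *m g 2%N + f 3%N *m g 1%N +
  f 4%N *m g 0%N.
Proof. by rewrite /cauchy !big_ord_recr big_ord0 /= add0r. Qed.

Definition cauchyE := (cauchy0E, cauchy1E, cauchy2E, cauchy3E, cauchy4E).
End CauchyExpansion.

Lemma ode_coefS (K : numFieldType) (N : nat) (a : nat -> 'M[K]_N) (k : nat) :
  (k < 4)%N -> k.+1%:R *: ode_coef a k.+1 = cauchy a (ode_coef a) k.
Proof.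
case: k => [|[|[|[|//]]]] _; rewrite cauchyE /ode_coef /= mulmx1.
- by rewrite scale1r.
- by rewrite scalerA divff ?pnatr_eq0 // scale1r addrC.
- rewrite scalerA divff ?pnatr_eq0 // scale1r.
  by rewrite addrC [X in _ + X]addrC addrA.
- rewrite scalerA divff ?pnatr_eq0 // scale1r.
  by rewrite addrC [X in _ + X]addrC [X in _ + (_ + X)]addrC !addrA.
Qed.

(** Both sides are linear combinations of the same words in [a 0], ..., [a 3].
    In degree 4, for instance, the coefficient of [a0 a0 a1] is
    [1/2 * 1/6 - 1/24] on the left, and [1/24] on the right. *)
Lemma magnus_coefE (K : numFieldType) (N : nat) (a x y : nat -> 'M[K]_N) (k : nat) :
  x 0%N = 0 -> x 1%N = a 0%N -> x 2%N = 2^-1 *: a 1%N ->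
  x 3%N = 3^-1 *: a 2%N -> x 4%N = 4^-1 *: a 3%N ->
  y 0%N = 0 -> y 1%N = 0 -> y 2%N = a 1%N -> y 3%N = a 2%N ->
  (k < 5)%N -> magnus_coef x y k = ode_coef a k.
Proof.
move=> x0 x1 x2 x3 x4 y0 y1 y2 y3; rewrite /magnus_coef.
have red := (x0, x1, x2, x3, x4, y0, y1, y2, y3, mul0mx, mulmx0, addr0, add0r,
  scaler0, oppr0).
case: k => [|[|[|[|[|//]]]]] _; rewrite !cauchyE /ode_coef /=.
- by rewrite !red.
- by rewrite !red.
- by rewrite !red scalerDr.
- rewrite !red; move: (a 0%N) (a 1%N) (a 2%N) => a0 a1 a2.
  rewrite !(mulmxDl, mulmxDr, mulmxA, =^~ scalemxAl, =^~ scalemxAr).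
  move: (a0 *m a0 *m a0) (a0 *m a1) (a1 *m a0) => w1 w2 w3.
  apply/matrixP => i j; rewrite !mxE; by field.
- rewrite !red; move: (a 0%N) (a 1%N) (a 2%N) (a 3%N) => a0 a1 a2 a3.
  rewrite !(mulmxDl, mulmxDr, mulmxA, =^~ scalemxAl, =^~ scalemxAr).
  move: (a0 *m a0 *m a0 *m a0) (a0 *m a0 *m a1) (a0 *m a1 *m a0).
  move: (a1 *m a0 *m a0) (a0 *m a2) (a1 *m a1) (a2 *m a0).
  move=> w1 w2 w3 w4 w5 w6 w7.
  apply/matrixP => i j; rewrite !mxE. by field.
Qed.

(** * Taylor expansions of matrix functions *)

Lemma Rcomplex_scaleE (R : realType) (r : R) (z : Rcomplex R) :
  r *: z = r%:C * z.
Proof.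
by case: z => x y; rewrite /GRing.scale /=; simpc.
Qed.

Section Taylor.
Variables (R : realType) (N : nat).
Implicit Types (F G : R -> 'M[R[i]]_N) (f g : nat -> 'M[R[i]]_N) (n : nat).

Definition taylor n F f := expansion n F (fun k t => (t ^+ k)%:C *: f k).

Lemma taylor_intro n F f :
  small n (fun t => F t - \sum_(k < n) (t ^+ k)%:C *: f k) -> taylor n F f.
Proof.
by move=> hF; split=> // k; rewrite -[k in small k]addn0;
  apply/small_mulX/small_cst.
Qed.

Lemma taylor_ext n F f g :
  (forall k, (k < n)%N -> f k = g k) -> taylor n F f -> taylor n F g.
Proof.
move=> fg [_ hF]; apply: taylor_intro; apply: small_eq hF => t.
by congr (_ - _); apply: eq_bigr => k _; rewrite fg.
Qed.

Lemma taylor1 n : taylor n (fun=> 1%:M) (fun k => if k is 0%N then 1%:M else 0).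
Proof.
apply: taylor_intro; case: n => [|n].
  by apply: small_eq (small_cst 1%:M) => t; rewrite big_ord0 subr0.
apply: small_eq (small0 _ _ _) => t.
rewrite big_ord_recl expr0 scale1r big1 ?addr0 ?subrr // => k _.
exact: scaler0.
Qed.

Lemma taylorD n F G f g : taylor n F f -> taylor n G g ->
  taylor n (fun t => F t + G t) (fun k => f k + g k).
Proof.
move=> hF hG; apply: expansion_eq (expansionD hF hG) => // k t.
by rewrite scalerDr.
Qed.

Lemma taylorZ r n F f : taylor n F f ->
  taylor n (fun t => r%:C *: F t) (fun k => r%:C *: f k).
Proof.
move=> hF; apply: expansion_eq (expansionZ r hF) => // k t.
by rewrite !scalerA mulrC.
Qed.

Lemma taylorB n F G f g : taylor n F f -> taylor n G g ->
  taylor n (fun t => F t - G t) (fun k => f k - g k).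
Proof.
move=> hF /(taylorZ (-1)) hG.
apply: expansion_eq (taylorD hF hG) => [t|k t];
  by rewrite rmorphN1 scaleN1r.
Qed.

Lemma taylorM n F G f g : taylor n F f -> taylor n G g ->
  taylor n (fun t => F t *m G t) (cauchy f g).
Proof.
move=> hF hG; apply: expansion_eq (expansionM hF hG) => // k t.
rewrite scaler_sumr; apply: eq_bigr => j _.
rewrite -scalemxAl -scalemxAr scalerA -rmorphM -exprD subnKC //.
exact: (ltn_ord j).
Qed.

Lemma taylor_scale r n F f : taylor n F f ->
  taylor n (fun t => F (r * t)) (fun k => (r ^+ k)%:C *: f k).
Proof.
move=> [_ hF]; apply: taylor_intro; apply: small_eq (small_scale r hF) => t.
congr (_ - _); apply: eq_bigr => k _.
by rewrite exprMn rmorphM scalerA mulrC.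
Qed.

Definition shift_coef f k := if k is k'.+1 then f k' else 0.

Lemma taylor_mulX n F f : taylor n F f ->
  taylor n.+1 (fun t => t%:C *: F t) (shift_coef f).
Proof.
move=> [_ hF]; apply: taylor_intro.
apply: small_eq (small_mulX 1 hF) => t.
rewrite expr1 scalerBr big_ord_recl scaler0 add0r scaler_sumr.
congr (_ - _); apply: eq_bigr => k _.
by rewrite scalerA -rmorphM -exprS.
Qed.

Lemma analytic_taylor F : analytic_near0 F ->
  exists f, forall n, taylor n F f.
Proof.
move=> /nbhs_singleton aF.
pose a i j := sval (cid (aF i j)).
have aP i j : \forall t \near (0 : R),
    series (fun k => t ^+ k *: a i j k) @ \oo --> entry F i j t.
  rewrite /a; case: cid => b /= ; apply: filterS => t.
  by under [X in series X]eq_fun do rewrite subr0.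
exists (fun k => \matrix_(i, j) a i j k) => n; apply: taylor_intro.
apply: small_entries => i j.
have [C hC] := power_series_remainder n (aP i j).
exists C; apply: filterS hC => t; congr (`|_| <= _).
rewrite /entry !mxE summxE; congr (_ - _).
apply: eq_bigr => k _; rewrite !mxE.
exact: Rcomplex_scaleE.
Qed.

End Taylor.

(** * Taylor expansion of the fundamental matrix *)

Section LinearODE.
Variables (R : realType) (N : nat).
Implicit Types (E A P : R -> 'M[R[i]]_N).

Lemma small_primitive n E (D : R -> 'M[R[i]]_N) :
  E 0 = 0 ->
  (\forall t \near (0 : R), forall i j,
     is_derive t (1 : R) (entry E i j) (D t i j : Rcomplex R)) ->
  small n D -> small n.+1 E.
Proof.
move=> E0 ED /small_pos[C C0 DC]; apply: small_entries => i j.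
exists (2 * C).
apply: (@complex_mean_value_bigO _ (entry E i j) (entry D i j) n C (ltW C0)).
- by rewrite /entry E0 mxE.
- by apply: filterS ED => t; apply.
- by apply: filterS DC => t; apply: le_trans; apply: entry_le_mnorm.
Qed.

Lemma derivable_locally_bounded (V : normedModType R) (f : R -> V) (df : V) :
  is_derive (0 : R) (1 : R) f df ->
  exists C : R, \forall t \near (0 : R), `|f t| <= C.
Proof.
move=> [/derivable1_diffP/differentiable_continuous cf _].
exists (`|f 0| + 1); near=> t; near: t.
by apply: (cvgr_norm_le _ cf); rewrite ltrDl.
Unshelve. all: by end_near. Qed.

Lemma is_derive_powZ (V : normedModType R) (k : nat) (v : V) (t : R) :
  is_derive t (1 : R) (fun s : R => s ^+ k *: v) ((k%:R * t ^+ k.-1) *: v).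
Proof.
have hX : is_derive t (1 : R) (fun s : R => s ^+ k) (k%:R * t ^+ k.-1).
  have -> : (fun s : R => s ^+ k) = id ^+ k.
    by apply/funext => s; elim: k => // k IH; rewrite !exprS IH.
  by apply: is_derive_eq (is_deriveX k (is_derive_id t 1)) _; rewrite [_ *: _]mulr1.
have gB (x y : R) : (x - y) *: v = x *: v - y *: v by rewrite scalerBl.
have gZ (r x : R) : (r *: x) *: v = r *: (x *: v) by rewrite scalerA.
exact: (is_derive_linear gB gZ (@scalel_continuous _ _ v) hX).
Qed.

(** If [P] is known up to [O(t^n)], then so is [P' = A P], by the Cauchy product.
    The recursion says that this expansion is the derivative of the next partial
    sum, so that the new remainder has derivative [O(t^n)]. The induction starts
    from the boundedness of [P]. *)
Lemma ode_taylor A P a p n :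
  fundamental_matrix A P -> (forall m, taylor m A a) ->
  p 0%N = 1%:M ->
  (forall k, (k.+1 < n)%N -> k.+1%:R *: p k.+1 = cauchy a p k) ->
  taylor n P p.
Proof.
move=> [P0 PD] Aa p0; elim: n => [|n IH] rec.
  apply: taylor_intro; apply: small_entries => i j.
  have [C hC] := derivable_locally_bounded (nbhs_singleton PD i j).
  exists C; apply: filterS hC => t; rewrite expr0 mulr1.
  by rewrite /entry big_ord0 subr0.
have {}IH := IH (fun k kn => rec k (ltnW kn)).
apply: taylor_intro.
apply: (@small_primitive n _ (fun t => A t *m P t -
    \sum_(k < n) (t ^+ k)%:C *: cauchy a p k)).
- rewrite P0 big_ord_recl expr0 scale1r p0 big1 ?addr0 ?subrr // => k _.
  by rewrite expr0n scale0r.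
- apply: filterS PD => t PDt i j.
  have hD (k : 'I_n.+1) := is_derive_powZ k (p k i j : Rcomplex R) t.
  have h := is_deriveB (PDt i j) (is_derive_sum hD).
  have -> : entry (fun t => P t - \sum_(k < n.+1) (t ^+ k)%:C *: p k) i j =
      entry P i j - \sum_(k < n.+1) (fun s : R => s ^+ k *: (p k i j : Rcomplex R)).
    apply/funext => s; rewrite /entry !fctE fct_sumE !mxE summxE.
    by congr (_ - _); apply: eq_bigr => k _; rewrite mxE Rcomplex_scaleE.
  apply: is_derive_eq h _.
  rewrite big_ord_recl mul0r scale0r add0r [RHS]mxE [X in _ = _ + X]mxE summxE.
  congr (_ - _); apply: eq_bigr => k _.
  rewrite -rec ?ltnS // !mxE lift0 /= Rcomplex_scaleE rmorphM rmorph_nat.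
  by rewrite mulrCA mulrA.
by have [] := taylorM (Aa n) IH.
Qed.

End LinearODE.

(** * The two exponents alpha1 and alpha2 *)

Section GaussNodes.
Variable R : realType.

(** The two-point Gauss rule on [[0, 1]] is exact up to degree 3. *)
Lemma gauss_mean (k : nat) : (k < 4)%N ->
  2^-1 * (c1 R ^+ k + c2 R ^+ k) = k.+1%:R^-1.
Proof.
have s3 : Num.sqrt (3 : R) ^+ 2 = 3 by rewrite sqr_sqrtr.
rewrite /c1 /c2; move: (Num.sqrt 3) s3 => s s3.
have s3' : s ^+ 3 = 3 * s by rewrite exprS s3 mulrC.
by case: k => [|[|[|[|//]]]] _; field: s3 s3'.
Qed.

Lemma gauss_difference (k : nat) : (k < 3)%N ->
  Num.sqrt 3 * (c2 R ^+ k - c1 R ^+ k) = (k != 0%N)%:R.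
Proof.
have s3 : Num.sqrt (3 : R) ^+ 2 = 3 by rewrite sqr_sqrtr.
rewrite /c1 /c2; move: (Num.sqrt 3) s3 => s s3.
by case: k => [|[|[|//]]] _; rewrite ?mulr1n ?mulr0n; field: s3.
Qed.

End GaussNodes.

Section Composition.
Variables (R : realType) (N : nat) (A : R -> 'M[R[i]]_N) (a : nat -> 'M[R[i]]_N).
Hypothesis Aa : forall n, taylor n A a.

Let x := shift_coef
  (fun k => (2^-1)%:C *: ((c1 R ^+ k)%:C *: a k + (c2 R ^+ k)%:C *: a k)).
Let y := shift_coef
  (fun k => (Num.sqrt 3)%:C *: ((c2 R ^+ k)%:C *: a k - (c1 R ^+ k)%:C *: a k)).

Lemma alpha1_taylor n : taylor n.+1 (alpha1 A) x.
Proof.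
have h := taylor_mulX (taylorZ 2^-1
  (taylorD (taylor_scale (c1 R) (Aa n)) (taylor_scale (c2 R) (Aa n)))).
by apply: expansion_eq h => // t; rewrite scalerA -rmorphM.
Qed.

Lemma alpha2_taylor n : taylor n.+1 (alpha2 A) y.
Proof.
have h := taylor_mulX (taylorZ (Num.sqrt 3)
  (taylorB (taylor_scale (c2 R) (Aa n)) (taylor_scale (c1 R) (Aa n)))).
by apply: expansion_eq h => // t; rewrite scalerA -rmorphM mulrC.
Qed.

Lemma alpha1_coef k : (k < 4)%N -> x k.+1 = k.+1%:R^-1 *: a k.
Proof.
move=> k4; rewrite /x /= -scalerDl scalerA -rmorphD -rmorphM gauss_mean //.
by rewrite fmorphV rmorph_nat.
Qed.

(** The constant term of [A] cancels in the difference, so that [alpha2] is of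
    order 2. *)
Lemma alpha2_coef k : (k < 3)%N -> y k.+1 = (k != 0%N)%:R *: a k.
Proof.
move=> k3; rewrite /y /= -scalerBl scalerA -rmorphB -rmorphM gauss_difference //.
by rewrite rmorph_nat.
Qed.

Lemma alpha1_small : small 1 (alpha1 A).
Proof.
have [_] := alpha1_taylor 0; apply: small_eq => t.
by rewrite big_ord1 scaler0 subr0.
Qed.

Lemma alpha2_small : small 2 (alpha2 A).
Proof.
have [_] := alpha2_taylor 1; apply: small_eq => t.
by rewrite big_ord_recl big_ord1 alpha2_coef // scale0r !scaler0 addr0 subr0.
Qed.

Lemma Psi_word_expansion :
  word_expansion (alpha1 A) (alpha2 A) (Psi A) (psi_coef (w21 R) (w32 R) (w22 R)).
Proof.
have cay := Cay_word_expansion alpha1_small alpha2_small.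
have h := word_expansionM
  (word_expansionM
  (word_expansionM
  (word_expansionM
  (cay (w21 R) (w32 R)) (cay (w21 R) (w22 R))) (cay (1 - 4 * w21 R) 0))
  (cay (w21 R) (- w22 R))) (cay (w21 R) (- w32 R)).
have cayN r s t : Cay (r%:C *: alpha1 A t + (- s)%:C *: alpha2 A t) =
    Cay (r%:C *: alpha1 A t - s%:C *: alpha2 A t).
  by rewrite rmorphN scaleNr.
have cay0 r t : Cay (r%:C *: alpha1 A t + 0%:C *: alpha2 A t) =
    Cay (r%:C *: alpha1 A t).
  by rewrite scale0r addr0.
move=> n; apply: expansion_eq (h n) => [t|k t]; last by [].
by rewrite (cay0 _ t) (cayN (w21 R) (w22 R) t) (cayN (w21 R) (w32 R) t).
Qed.

Lemma Psi_magnus_poly :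
  small 5 (fun t => Psi A t - magnus_poly (alpha1 A t) (alpha2 A t)).
Proof.
have [_] := Psi_word_expansion 5; apply: small_eq => t.
by rewrite (sum_word_part_Psi (w21_cubic R) (w22E R)).
Qed.

Lemma magnus_poly_taylor :
  taylor 5 (fun t => magnus_poly (alpha1 A t) (alpha2 A t)) (magnus_coef x y).
Proof.
have hx := alpha1_taylor 4; have hy := alpha2_taylor 4.
have hxx := taylorM hx hx; have hxxx := taylorM hx hxx.
have hxxxx := taylorM hx hxxx; have hxxy := taylorM hx (taylorM hx hy).
have hyxx := taylorM hy hxx.
have h := taylorD (taylorD (taylorD (taylorD (taylor1 _ _ 5) hx) (taylorZ 2^-1 hxx))
  (taylorB (taylorZ 6^-1 hxxx)
    (taylorZ 12^-1 (taylorB (taylorM hx hy) (taylorM hy hx)))))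
  (taylorB (taylorZ 24^-1 hxxxx) (taylorZ 24^-1 (taylorB hxxy hyxx))).
apply: taylor_ext h => k _.
have inv m : (m%:R^-1)%:C = m%:R^-1 :> R[i] by rewrite fmorphV rmorph_nat.
by rewrite /magnus_coef !inv.
Qed.

Lemma magnus_coef_alpha k : (k < 5)%N -> magnus_coef x y k = ode_coef a k.
Proof.
apply: magnus_coefE; rewrite ?alpha1_coef ?alpha2_coef //.
- by rewrite invr1 scale1r.
- by rewrite scale0r.
- by rewrite scale1r.
- by rewrite scale1r.
Qed.

End Composition.

(** * The order of the method *)

Theorem mainTheorem1 (R : realType) (N : nat) (A P : R -> 'M[R[i]]_N)
    (hA : analytic_near0 A) (hP : fundamental_matrix A P) :
  matrix_bigO_pow (fun h : R => Psi A h - P h) 5.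
Proof.
have [a Aa] := analytic_taylor hA.
have P_taylor : taylor 5 P (ode_coef a).
  by apply: (ode_taylor hP Aa) => // k k4; apply: ode_coefS.
have M_taylor := taylor_ext (@magnus_coef_alpha R N a) (magnus_poly_taylor Aa).
apply: small_bigO.
have := smallD (Psi_magnus_poly Aa) (expansion_unique M_taylor P_taylor).
by apply: small_eq => t; rewrite addrA subrK.
Qed.
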